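(* If $G$ is a contractible graph, then $\phi(G)=\mathrm{SDet}(A)=1$. If $G$ is a $d$-sphere with $d\ge0$, then $\phi(G)=\mathrm{SDet}(C)=1$. Here $A$ is the Dirac operator of $G$ with the first row and column deleted, and $C$ is the Dirac operator of $G$ with the first and last rows and the first and last columns deleted.
   Context: Let $G=(V,E)$ be a finite simple graph. A $k$-simplex of $G$ is (the vertex set of) a complete subgraph $K_{k+1}$; $f_k$ is the number of $k$-simplices. Order the vertices; for a $(k+1)$-simplex $x=\{v_0<\dots<v_{k+1}\}$ and $y=x\setminus\{v_i\}$ put $\mathrm{sign}(y,x)=(-1)^i$. The exterior derivative $d_k$ is the $f_{k+1}\times f_k$ matrix given by $d_kf(x)=\sum_{y\subset x,\ \dim y=k}\mathrm{sign}(y,x)f(y)$. These assemble to an $n\times n$ matrix $d$ on functions on all $n=\sum_kf_k$ simplices, and $D=d+d^*$ is the Dirac operator. The simplices indexing rows and columns are ordered by increasing dimension, so the first index is a vertex and the last index is a simplex of maximal dimension. The pseudo determinant $\mathrm{Det}(M)$ of a square matrix $M$ is the product of its non-zero eigenvalues, counted with multiplicity (equal to $1$ if there are none, in particular for an empty matrix). For a matrix of the form $T=e+e^*$ obtained from $D$ by deleting rows and the corresponding columns, let $e_k$ be the matrix obtained from $d_k$ by deleting the columns and rows indexed by deleted simplices; then $\mathrm{SDet}(T)=\prod_k\mathrm{Det}(e_k^*e_k)^{(-1)^k}$. Define $\phi(G)=\mathrm{SDet}(A)$ for contractible $G$ and $\phi(G)=\mathrm{SDet}(C)$ for spheres $G$.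 The unit sphere $S(v)$ of a vertex $v$ is the subgraph induced by the neighbors of $v$; $G-v$ is the subgraph induced by $V\setminus\{v\}$. Contractible graphs are defined inductively: the one-point graph $K_1$ is contractible, and $G$ is contractible if there is a vertex $v$ such that both $S(v)$ and $G-v$ are contractible. Spheres are defined inductively: the empty graph is the $(-1)$-sphere, and for $k\ge0$ a $k$-sphere is a graph all of whose unit spheres are $(k-1)$-spheres and such that $G-v$ is contractible for some vertex $v$. *)

(* Defs.v *)
From HB Require Import structures.
From mathcomp Require Import all_boot all_order all_algebra.
From mathcomp Require Import spectral boolp.
Set Implicit Arguments.
Unset Strict Implicit.
Unset Printing Implicit Defensive.
Import Order.TTheory GRing.Theory Num.Theory.
Local Open Scope ring_scope.
Local Open Scope sesquilinear_scope.

(* A finite simple graph is a symmetric irreflexive relation [e] on a finite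
   type [T] of vertices.  Its induced subgraphs are represented by their vertex
   sets [W : {set T}], the whole graph being [[set: T]]; an induced subgraph of
   an induced subgraph is again of this form. *)

Definition unit_sphere (T : finType) (e : rel T) (W : {set T}) (v : T)
  : {set T} := [set w in W | e v w].

Inductive contractible (T : finType) (e : rel T) : {set T} -> Prop :=
| contractible_point v : contractible e [set v]
| contractible_extend (W : {set T}) (v : T) :
    v \in W -> contractible e (unit_sphere e W v) ->
    contractible e (W :\ v) -> contractible e W.

Inductive sphere (T : finType) (e : rel T) : int -> {set T} -> Prop :=
| sphere_empty : sphere e (-1) set0
| sphere_step (k : int) (W : {set T}) :
    0 <= k ->
    (forall v, v \in W -> sphere e (k - 1) (unit_sphere e W v)) ->
    (exists2 v, v \in W & contractible e (W :\ v)) ->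
    sphere e k W.

Definition simplices (T : finType) (e : rel T) : {set {set T}} :=
  [set x : {set T} | (x != set0) &&
     [forall u in x, forall v in x, (u != v) ==> e u v]].

Definition dim (T : finType) (x : {set T}) : nat := #|x|.-1.

(* [s] lists all simplices, each exactly once, by increasing dimension;
   the order inside a given dimension is arbitrary. *)
Definition simplex_order (T : finType) (e : rel T) (n : nat)
    (s : n.-tuple {set T}) : bool :=
  perm_eq s (enum (simplices e)) && sorted (relpre (@dim T) leq) s.

(* The sum has at most one term: it is (-1)^i if y is x minus its i-th vertex
   (counted from 0 in the order of T), and 0 if y is not a facet of x. *)
Definition incidence (C : numClosedFieldType) (disp : Order.disp_t)
    (T : finOrderType disp) (y x : {set T}) : C :=
  \sum_(v in x | y == x :\ v) (-1) ^+ #|[set w in x | (w < v)%O]|.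

(* Its block with rows of dimension k+1 and columns of dimension k is d_k;
   its other blocks vanish. *)
Definition ext_derivative (C : numClosedFieldType) (disp : Order.disp_t)
    (T : finOrderType disp) (n : nat) (s : n.-tuple {set T}) : 'M[C]_n :=
  \matrix_(i, j) incidence C (tnth s j) (tnth s i).

Definition dirac (C : numClosedFieldType) (disp : Order.disp_t)
    (T : finOrderType disp) (n : nat) (s : n.-tuple {set T}) : 'M[C]_n :=
  ext_derivative C s + (ext_derivative C s)^t*.

Definition eigenvalues (C : numClosedFieldType) (n : nat) (M : 'M[C]_n)
  : seq C := sval (closed_field_poly_normal (char_poly M)).

Definition pdet (C : numClosedFieldType) (n : nat) (M : 'M[C]_n) : C :=
  \prod_(z <- eigenvalues M | z != 0) z.

(* [enum_val] lists the elements of a set of ordinals in increasing order, so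
   [principal K M] is M with the rows and columns outside K deleted. *)
Definition principal (C : numClosedFieldType) (n : nat) (K : {set 'I_n})
    (M : 'M[C]_n) : 'M[C]_#|K| :=
  mxsub enum_val enum_val M.

Definition degree_block (C : numClosedFieldType) (n : nat) (g : 'I_n -> nat)
    (M : 'M[C]_n) (p q : nat)
  : 'M[C]_(#|[set i | g i == p]|, #|[set j | g j == q]|) :=
  mxsub enum_val enum_val M.

(* Here [g i] is the dimension of the simplex indexing row and column i of M.
   For M = e + e^*, the block below is e_k (see [degree_block_principal_dirac]).
   For k >= max g it has no row, and such factors would be equal to 1. *)
Definition SDet (C : numClosedFieldType) (n : nat) (g : 'I_n -> nat)
    (M : 'M[C]_n) : C :=
  \prod_(k < \max_(i < n) g i)
    let ek := degree_block g M k.+1 k in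
    pdet (ek^t* *m ek) ^ ((-1) ^+ k).

Definition kept_dim (T : finType) (n : nat) (s : n.-tuple {set T})
    (K : {set 'I_n}) (i : 'I_#|K|) : nat := dim (tnth s (enum_val i)).

Definition keep_A (n : nat) : {set 'I_n} := [set i : 'I_n | (0 < i)%N].
Definition keep_C (n : nat) : {set 'I_n} := [set i : 'I_n | (0 < i < n.-1)%N].

Definition opA (C : numClosedFieldType) (disp : Order.disp_t)
    (T : finOrderType disp) (n : nat) (s : n.-tuple {set T})
  : 'M[C]_#|keep_A n| := principal (keep_A n) (dirac C s).

Definition opC (C : numClosedFieldType) (disp : Order.disp_t)
    (T : finOrderType disp) (n : nat) (s : n.-tuple {set T})
  : 'M[C]_#|keep_C n| := principal (keep_C n) (dirac C s).

Definition SDetA (C : numClosedFieldType) (disp : Order.disp_t)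
    (T : finOrderType disp) (n : nat) (s : n.-tuple {set T}) : C :=
  SDet (@kept_dim T n s (keep_A n)) (opA C s).

Definition SDetC (C : numClosedFieldType) (disp : Order.disp_t)
    (T : finOrderType disp) (n : nat) (s : n.-tuple {set T}) : C :=
  SDet (@kept_dim T n s (keep_C n)) (opC C s).

(* Meaningful only when the graph is contractible or a sphere. *)
Definition phi (C : numClosedFieldType) (disp : Order.disp_t)
    (T : finOrderType disp) (e : rel T) (n : nat) (s : n.-tuple {set T}) : C :=
  if `[< contractible e [set: T] >] then SDetA C s else SDetC C s.

Lemma incidence_card0 (C : numClosedFieldType) (disp : Order.disp_t)
    (T : finOrderType disp) (y x : {set T}) :
  #|x| != #|y|.+1 -> incidence C y x = 0.
Proof.
move=> xy; rewrite /incidence big1 // => v /andP[vx /eqP yE].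
by move: xy; rewrite (cardsD1 v x) vx yE eqxx.
Qed.

(* The blocks used in [SDet] are the matrices d_k with the rows and columns
   of the deleted simplices removed. *)
Lemma degree_block_principal_dirac (C : numClosedFieldType)
    (disp : Order.disp_t) (T : finOrderType disp) (n : nat)
    (s : n.-tuple {set T}) (K : {set 'I_n}) (k : nat) :
  degree_block (@kept_dim T n s K) (principal K (dirac C s)) k.+1 k =
  degree_block (@kept_dim T n s K) (principal K (ext_derivative C s)) k.+1 k.
Proof.
apply/matrixP => i j; rewrite !mxE [X in _ + X^*%R]incidence_card0.
  by rewrite conjC0 addr0.
have := enum_valP i; have := enum_valP j; rewrite !inE /kept_dim /dim.
set x := tnth _ _; set y := tnth _ _ => /eqP hx /eqP hy.
apply/eqP => xy; move: hx hy; rewrite xy => /= <- hy.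
by have := leq_pred #|y|; rewrite hy ltnn.
Qed.

(* Main.v *)
(* Delete the prescribed simplices and let S be the set of the others.  The
   cellular chain complex on S is exact over Z: a contractible graph has trivial
   reduced homology (attaching v to G - v is coning off the acyclic S(v)), and
   deleting a vertex removes H_0; a d-sphere has only a top class, which is
   +-1 on every facet, so that deleting any facet kills it.  By exactness
   and Smith normal form each incidence matrix factors over Z as e_k = U_k V_k
   with U_k split injective and V_k split surjective, whence
   Det(e_k^* e_k) = det(U_k^T U_k) det(V_k V_k^T).  Exactness also says that
   U_k and V_(k+1) are complementary, which forces
   det(U_k^T U_k) = det(V_(k+1) V_(k+1)^T), and the alternating product
   telescopes to 1. *)
Require Import Defs.
From mathcomp Require Import all_boot all_order all_algebra.
From mathcomp Require Import zify ring spectral boolp.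
Import Order.TTheory GRing.Theory Num.Theory.
Local Open Scope ring_scope.

Set Implicit Arguments.
Unset Strict Implicit.
Unset Printing Implicit Defensive.

(** * Pseudo determinants *)


Lemma char_poly_mulmxC (R : comNzRingType) (n r : nat)
    (X : 'M[R]_(n, r)) (Y : 'M[R]_(r, n)) :
  'X^r * char_poly (X *m Y) = 'X^n * char_poly (Y *m X).
Proof.
pose X' := map_mx polyC X; pose Y' := map_mx polyC Y.
(* Sylvester's identity: [M] is triangularized from the right and from the left. *)
pose M := block_mx 'X%:M X' Y' 1%:M.
have detM : \det M = char_poly (X *m Y).
  have : M *m block_mx 1%:M 0 (- Y') 1%:M =
         block_mx (char_poly_mx (X *m Y)) X' 0 1%:M.
    rewrite mulmx_block !mulmx1 !mulmxN !mulmx0 !mul1mx subrr add0r.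
    by rewrite /char_poly_mx map_mxM add0r.
  by move/(congr1 determinant); rewrite det_mulmx det_lblock det_ublock !det1 !mulr1.
have : block_mx 1%:M 0 (- Y') 'X%:M *m M =
       block_mx 'X%:M X' 0 (char_poly_mx (Y *m X)).
  rewrite mulmx_block !mul1mx !mul0mx !addr0 !mulNmx !mulmx1.
  by rewrite /char_poly_mx map_mxM -scalar_mxC addNr addrC.
move/(congr1 determinant); rewrite det_mulmx det_lblock det_ublock detM.
by rewrite det1 mul1r !det_scalar.
Qed.

Lemma char_poly_eigenvalues (C : numClosedFieldType) (n : nat) (M : 'M[C]_n) :
  char_poly M = \prod_(z <- eigenvalues M) ('X - z%:P).
Proof.
rewrite /eigenvalues; case: closed_field_poly_normal => rs /= {1}->.
by rewrite (monicP (char_poly_monic M)) scale1r.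
Qed.

(** The two spectra agree as multisets once padded with zeros, and zeros do not enter a pseudo
    determinant. *)
Lemma pdet_mulmxC (C : numClosedFieldType) (n r : nat)
    (X : 'M[C]_(n, r)) (Y : 'M[C]_(r, n)) : pdet (X *m Y) = pdet (Y *m X).
Proof.
have Xn k (t : seq C) : 'X^k * \prod_(z <- t) ('X - z%:P) =
    \prod_(z <- nseq k 0 ++ t) ('X - z%:P).
  by rewrite big_cat big_nseq /= subr0 iter_mulr_1.
have := char_poly_mulmxC X Y.
rewrite !char_poly_eigenvalues !Xn => /prod_XsubC_eq eq_ev.
have prod_nz k (t : seq C) :
    \prod_(z <- nseq k 0 ++ t | z != 0) z = \prod_(z <- t | z != 0) z.
  by rewrite big_cat /= big_nseq_cond eqxx mul1r.
by rewrite /pdet -(prod_nz r) -(prod_nz n (eigenvalues _)) (perm_big _ eq_ev).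
Qed.

Lemma pdet_det (C : numClosedFieldType) (n : nat) (M : 'M[C]_n) :
  \det M != 0 -> pdet M = \det M.
Proof.
have prodM : \prod_(z <- eigenvalues M) z = \det M.
  have szM : size (eigenvalues M) = n.
    by have := size_char_poly M; rewrite char_poly_eigenvalues size_prod_XsubC => -[].
  (* The constant coefficient of the characteristic polynomial is computed twice, and the sign
     [(-1) ^+ n] is cancelled. *)
  have := char_poly_det M; rewrite -horner_coef0 char_poly_eigenvalues horner_prod.
  rewrite (eq_bigr (fun z => -1 * z)) => [|z _]; last by rewrite !hornerE mulN1r.
  rewrite big_split /= big_const_seq count_predT szM iter_mulr_1.
  by move/mulfI => <- //; rewrite expf_neq0 // oppr_eq0 oner_eq0.
rewrite -prodM => nzM; rewrite /pdet [RHS](bigID (fun z => z != 0)) /=.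
rewrite [X in _ * X]big1_seq ?mulr1 // => z /andP[/negPn/eqP->] z_ev.
by move: nzM; rewrite (big_rem _ z_ev) /= mul0r eqxx.
Qed.

(** * Exact complexes of integer matrices *)


(** The only units of Z are 1 and -1, each its own inverse. *)
Lemma mulz_eq1_sym (a b : int) : a * b = 1 -> a = b.
Proof.
move=> ab1; have := intUnitRing.unitzPl (etrans (mulrC b a) ab1).
rewrite qualifE /= => /pred2P[] a1.
  by move: ab1; rewrite a1 mul1r.
by move: ab1; rewrite a1 mulN1r => /(congr1 -%R); rewrite opprK.
Qed.

(** The columns of [U] and the rows of [V] span primitive lattices that are orthogonal complements
    of each other in Z^n; such lattices have equal covolume. *)
Lemma gram_complement (n r r' : nat) (U : 'M[int]_(n, r)) (Q : 'M[int]_(r, n))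
    (V : 'M[int]_(r', n)) (R : 'M[int]_(n, r')) :
  Q *m U = 1%:M -> V *m R = 1%:M -> U *m Q + R *m V = 1%:M ->
  \det (U^T *m U) = \det (V *m V^T).
Proof.
move=> QU VR UQRV.
have QR : Q *m R = 0.
  have /(congr1 (fun M => Q *m M *m R)) := UQRV.
  rewrite mulmx1 mulmxDr mulmxDl !mulmxA QU mul1mx -!mulmxA VR mulmx1.
  by rewrite -[RHS]addr0 => /addrI.
have VU : V *m U = 0.
  have /(congr1 (fun M => V *m M *m U)) := UQRV.
  rewrite mulmx1 mulmxDr mulmxDl !mulmxA VR mul1mx -!mulmxA QU mulmx1.
  by rewrite -[RHS]addr0 => /addrI.
(* The two block matrices are mutually inverse, which also forces [n = r + r']. *)
have M1 : row_mx U R *m col_mx Q V = 1%:M by rewrite mul_row_col.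
have M2 : col_mx Q V *m row_mx U R = 1%:M.
  by rewrite mul_col_row QU QR VU VR -scalar_mx_block.
have En : n = (r + r')%N.
  by apply/eqP; rewrite eqn_leq (mulmx1_min M1) (mulmx1_min M2).
subst n.
(* With N = (U | V^T), det N relates both Gram determinants to the unimodular
   matrix (U | R), whose determinant is its own inverse. *)
have A1 : (row_mx U V^T)^T *m row_mx U R = block_mx (U^T *m U) (U^T *m R) 0 1%:M.
  by rewrite tr_row_mx trmxK mul_col_row VU VR.
have A2 : col_mx Q V *m row_mx U V^T = block_mx 1%:M (Q *m V^T) 0 (V *m V^T).
  by rewrite mul_col_row QU VU.
move/(congr1 determinant): A1; move/(congr1 determinant): A2.
rewrite !det_mulmx !det_ublock !det1 mul1r mulr1 det_tr => <- <-.
move/(congr1 determinant): M1; rewrite det_mulmx det1 => /mulz_eq1_sym ->.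
exact: mulrC.
Qed.

(** If [x V V^T = 0] then [x V] has squared norm 0, so it vanishes; the right inverse [R] then gives
    [x = 0]. *)
Lemma gram_neq0 (n r : nat) (V : 'M[int]_(r, n)) (R : 'M[int]_(n, r)) :
  V *m R = 1%:M -> \det (V *m V^T) != 0.
Proof.
move=> VR; apply/det0P => -[x nz_x xVV].
have xV0 : x *m V = 0.
  have /matrixP/(_ 0 0) : (x *m V) *m (x *m V)^T = 0.
    by rewrite trmx_mul !mulmxA -(mulmxA x) xVV mul0mx.
  rewrite [LHS]mxE [RHS]mxE => /eqP; rewrite psumr_eq0 => [/allP sq0|i _]; last first.
    by rewrite [_^T _ _]mxE -expr2 sqr_ge0.
  apply/rowP => i; have := sq0 i (mem_index_enum _).
  by rewrite [_^T _ _]mxE mulf_eq0 orbb => /eqP ->; rewrite mxE.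
by move: nz_x; rewrite -[x]mulmx1 -VR mulmxA xV0 mul0mx eqxx.
Qed.

(* Saturation of the row lattice forces the nonzero Smith invariants to be +-1. *)
Lemma saturated_factorization (m n : nat) (E : 'M[int]_(m, n)) :
  (forall (z : 'rV_n) (c : int) (y : 'rV_m),
     c != 0 -> c *: z = y *m E -> exists y', z = y' *m E) ->
  exists r (U : 'M_(m, r)) (V : 'M_(r, n)) (Q : 'M_(r, m)) (R : 'M_(n, r)),
    [/\ E = U *m V, Q *m U = 1%:M & V *m R = 1%:M].
Proof.
move=> satE; have [L uL [G uG [d d_sorted defE]]] := int_Smith_normal_form E.
set D := \matrix_(i, j) _ in defE.
(* The rank: by divisibility the zero invariants come last. Beyond the end of [d] the default value
   0 is read. *)
pose r := find (fun i => d`_i == 0) (iota 0 (minn m n)).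
have r_min : (r <= minn m n)%N by rewrite -[X in (_ <= X)%N](size_iota 0) find_size.
have [r_m r_n] : (r <= m)%N /\ (r <= n)%N by apply/andP; rewrite -leq_min.
have d_nz i : (i < r)%N -> d`_i != 0.
  move=> i_r; have := before_find 0%N i_r; rewrite nth_iota ?add0n => [->//|].
  exact: leq_trans i_r r_min.
have d_0 i : (r <= i < minn m n)%N -> d`_i = 0.
  case/andP=> r_i i_min.
  have r_lt : (r < minn m n)%N := leq_ltn_trans r_i i_min.
  have dr0 : d`_r = 0.
    apply/eqP; have := @nth_find _ 0%N (fun i => d`_i == 0) (iota 0 (minn m n)).
    by rewrite has_find -/r size_iota nth_iota // add0n; apply.
  have [i_d|?] := ltnP i (size d); last by rewrite nth_default.
  have := sorted_leq_nth dvdz_trans dvdzz 0 d_sorted.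
  move=> /(_ r i (leq_ltn_trans r_i i_d) i_d r_i).
  by rewrite dr0 dvd0z => /eqP.
(* [d_i] times row [i] of [G] lies in the row lattice of [E], so by saturation the row itself does.
   Its coordinate in the basis [G] exhibits [d_i] as a divisor of 1. *)
have d_sq i : (i < r)%N -> d`_i * d`_i = 1.
  move=> i_r; pose im := Ordinal (leq_trans i_r r_m); pose jn := Ordinal (leq_trans i_r r_n).
  have rowD : row im D = d`_i *: delta_mx 0 jn.
    by apply/rowP => j; rewrite !mxE eqxx /= eq_sym -val_eqE /= mulr_natr.
  have dG : d`_i *: row jn G = row im (invmx L) *m E.
    rewrite defE -row_mul !mulmxA mulVmx // mul1mx row_mul rowD -scalemxAl.
    by rewrite -rowE.
  have [y /(congr1 (mulmx^~ (invmx G)))] := satE _ _ _ (d_nz i i_r) dG.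
  rewrite -row_mul mulmxV // row1 defE !mulmxA mulmxK //.
  move/matrixP/(_ 0 jn); rewrite !mxE !eqxx (bigD1 im) //= big1 => [|j ne_j].
    rewrite addr0 [D _ _]mxE eqxx => /esym yd.
    by have {1}<- : (y *m L) 0 im = d`_i by exact: mulz_eq1_sym.
  rewrite [D j jn]mxE -[(j : nat) == _]/(val j == val im) val_eqE (negbTE ne_j).
  by rewrite mulr0n mulr0.
(* The signs [d_i], padded with 1 so that [S] is an involution. *)
pose S : 'M[int]_m := diag_mx (\row_i if (i < r)%N then d`_i else 1).
have SS : S *m S = 1%:M.
  apply/matrixP => i j; rewrite mul_diag_mx !mxE; case: ltnP => [i_r|_].
    by rewrite mulrnAr d_sq.
  by rewrite mul1r.
have defD : D = S *m pid_mx r.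
  apply/matrixP => i j; rewrite mul_diag_mx !mxE; case: ltnP => [i_r|r_i].
    by rewrite andbT mulr_natr.
  rewrite andbF mulr0; case: eqP => [eq_ij|//]; rewrite d_0 // r_i leq_min ltn_ord.
  by rewrite eq_ij ltn_ord.
exists r, (L *m S *m pid_mx r), (pid_mx r *m G), (pid_mx r *m S *m invmx L),
  (invmx G *m pid_mx r); split.
- by rewrite defE defD -!mulmxA (mulmxA (pid_mx r)) pid_mx_id.
- by rewrite !mulmxA mulmxKV // -(mulmxA _ S S) SS mulmx1 pid_mx_id ?pid_mx_1.
- by rewrite !mulmxA mulmxK // pid_mx_id ?pid_mx_1.
Qed.

Lemma adjmx_intr (C : numClosedFieldType) (m n : nat) (A : 'M[int]_(m, n)) :
  (map_mx intr A : 'M[C]_(m, n))^t*%sesqui = map_mx intr A^T.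
Proof. by apply/matrixP => i j; rewrite !mxE rmorph_int. Qed.

(** Moving [V] cyclically to the front turns [V^T (U^T U) V] into the invertible matrix
    [(V V^T) (U^T U)] without changing the pseudo determinant. *)
Lemma pdet_gram_factorization (C : numClosedFieldType) (m n r : nat)
    (U : 'M[int]_(m, r)) (V : 'M[int]_(r, n)) (E : 'M[C]_(m, n)) :
  E = map_mx intr (U *m V) ->
  \det (U^T *m U) != 0 -> \det (V *m V^T) != 0 ->
  pdet (E^t* *m E)%sesqui = (\det (V *m V^T) * \det (U^T *m U))%:~R.
Proof.
move=> -> nzU nzV; rewrite adjmx_intr -map_mxM trmx_mul /=.
have -> : V^T *m U^T *m (U *m V) = V^T *m (U^T *m U) *m V by rewrite !mulmxA.
rewrite map_mxM pdet_mulmxC -map_mxM mulmxA pdet_det det_map_mx det_mulmx //.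
by rewrite intr_eq0 mulf_neq0.
Qed.

(** With [g_k = det (V_k V_k^T)], factor [k] is [g_k g_(k+1)] to the power [(-1)^k]. Since
    [g_0 = 1], the first [N] factors leave only a power of [g_N], and [n N.+1 = 0] makes [g_N] the
    determinant of an empty matrix. *)
Lemma prod_pdet_exact (C : numClosedFieldType) (n : nat -> nat)
    (E : forall k, 'M[int]_(n k.+1, n k)) (N : nat) :
  (forall k, E k.+1 *m E k = 0) ->
  (forall z : 'rV_(n 0%N), exists y, z = y *m E 0%N) ->
  (forall k (z : 'rV_(n k.+1)), z *m E k = 0 -> exists y, z = y *m E k.+1) ->
  n N.+1 = 0%N ->
  \prod_(k < N)
    pdet ((map_mx intr (E k) : 'M[C]_(_, _))^t* *m map_mx intr (E k))%sesqui
     ^ ((-1) ^+ k) = 1.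
Proof.
move=> E2 ex0 exS nN.
pose F k :=
  pdet ((map_mx intr (E k) : 'M[C]_(_, _))^t* *m map_mx intr (E k))%sesqui.
(* By exactness the row lattice of [E k] is everything or a kernel, and kernels over Z are
   saturated. *)
have satE k z c (y : 'rV_(n k.+1)) :
    c != 0 -> c *: z = y *m E k -> exists y', z = y' *m E k.
  move=> nz_c; case: k z y => [|k] z y def_cz; first exact: ex0.
  apply: exS; apply: (scalemx_inj nz_c).
  by rewrite scalemxAl def_cz -mulmxA E2 mulmx0 scaler0.
suff [r [U [V [Q [R [[_ QU _] ->]]]]]] :
    exists r (U : 'M_(n N.+1, r)) (V : 'M_(r, n N)) Q R,
    [/\ E N = U *m V, Q *m U = 1%:M & V *m R = 1%:M] /\
    \prod_(k < N) F k ^ ((-1) ^+ k) =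
      ((\det (V *m V^T))%:~R : C) ^ ((-1) ^+ N.+1).
  have r0 : r = 0%N by have := mulmx1_min QU; rewrite nN leqn0 => /eqP.
  by subst r; rewrite det_mx00 exp1rz.
elim: N {nN} => [|N [r [U [V [Q [R [[defE QU VR] prodF]]]]]]].
  have [r [U [V [Q [R [defE QU VR]]]]]] := saturated_factorization (@satE 0%N).
  exists r, U, V, Q, R; split=> //; rewrite big_ord0.
  (* Surjectivity of [E 0] makes the empty [U] complementary to [V], and an empty Gram determinant
     is 1. *)
  suff <- : \det ((0 : 'M[int]_(n 0%N, 0))^T *m (0 : 'M[int]_(n 0%N, 0))) =
            \det (V *m V^T) by rewrite det_mx00 exp1rz.
  apply: (@gram_complement _ _ _ _ 0 _ R) => //; first by apply/matrixP => -[].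
  rewrite mulmx0 add0r; apply/row_matrixP => i; rewrite row1 rowE.
  have [y ->] := ex0 (delta_mx 0 i).
  by rewrite defE !mulmxA -(mulmxA _ V R) VR mulmx1.
have [r' [U' [V' [Q' [R' [defE' QU' VR']]]]]] := saturated_factorization (@satE N.+1).
exists r', U', V', Q', R'; split=> //.
have VU : V' *m U = 0.
  have := E2 N; rewrite defE defE' => /(congr1 (fun M => Q' *m M *m R)).
  by rewrite -!mulmxA VR mulmx1 !mulmxA QU' mul1mx mulmx0 mul0mx.
(* The rows of [1 - U Q] are killed by [E N], so by exactness they lie in the row lattice of [V'],
   on which [R' V'] is the identity. *)
have compl : (1%:M - U *m Q) *m (R' *m V') = 1%:M - U *m Q.
  apply/row_matrixP => i; rewrite row_mul.
  have [|y ->] := exS N (row i (1%:M - U *m Q)).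
    rewrite -row_mul defE mulmxA mulmxBl mul1mx -mulmxA QU mulmx1 subrr.
    by rewrite mul0mx row0.
  by rewrite defE' !mulmxA -(mulmxA _ V' R') VR' mulmx1.
(* Correcting [Q] makes the two splittings complementary. *)
have gramE : \det (U^T *m U) = \det (V' *m V'^T).
  apply: (@gram_complement _ _ _ _ (Q - Q *m R' *m V') _ R') => //.
    by rewrite mulmxBl QU -!mulmxA VU !mulmx0 subr0.
  have UQR : U *m (Q *m R' *m V') = R' *m V' - (1%:M - U *m Q) *m (R' *m V').
    by rewrite mulmxBl mul1mx opprB addrC subrK !mulmxA.
  by rewrite mulmxBr UQR compl opprB addrA subrK addrC subrK.
rewrite big_ord_recr prodF /F (pdet_gram_factorization (U := U) (V := V)) ?defE //;
  rewrite ?gramE ?(gram_neq0 VR) ?(gram_neq0 VR') //=.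
have nz : (\det (V *m V^T))%:~R != 0 :> C by rewrite intr_eq0 (gram_neq0 VR).
rewrite intrM exprzMl ?unitfE ?intr_eq0 ?(gram_neq0 VR) ?(gram_neq0 VR') //.
rewrite mulrA -expfzDr // exprS mulN1r addNr expr0z mul1r.
by rewrite !exprS mulrA mulrNN !mul1r.
Qed.

(** * Simplicial chains *)


(** As [v] itself is not counted, the sign is the same for [x] and for [v |: x]. *)
Definition sgn (disp : Order.disp_t) (T : finOrderType disp) (v : T)
    (x : {set T}) : int := (-1) ^+ #|[set w in x | (w < v)%O]|.

(* A chain is an integer function on all sets of vertices.  The empty set counts
   as the simplex of dimension -1, so the homology computed here is reduced. *)
Definition bd (disp : Order.disp_t) (T : finOrderType disp)
    (z : {set T} -> int) (y : {set T}) : int :=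
  \sum_(v | v \notin y) sgn v y * z (v |: y).

(** The part of a chain around [v], carried over to the unit sphere; [cone] inverts it on chains
    avoiding [v]. *)
Definition link (disp : Order.disp_t) (T : finOrderType disp) (v : T)
    (z : {set T} -> int) (y : {set T}) : int :=
  if v \in y then 0 else sgn v y * z (v |: y).

Definition cone (disp : Order.disp_t) (T : finOrderType disp) (v : T)
    (z : {set T} -> int) (x : {set T}) : int :=
  if v \in x then sgn v (x :\ v) * z (x :\ v) else 0.

Lemma sgn_sq (disp : Order.disp_t) (T : finOrderType disp) (v : T) (x : {set T}) :
  sgn v x * sgn v x = 1.
Proof. by rewrite /sgn -expr2 sqrr_sign. Qed.

Lemma sgnU1 (disp : Order.disp_t) (T : finOrderType disp) (v w : T) (x : {set T}) :
  w \notin x -> sgn v (w |: x) = (-1) ^+ (w < v)%O * sgn v x.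
Proof.
move=> wx; rewrite /sgn -exprD; congr (_ ^+ _).
case w_v: (w < v)%O.
  have -> : [set u in w |: x | (u < v)%O] = w |: [set u in x | (u < v)%O].
    by apply/setP => u; rewrite !inE; case: eqVneq => [->|//]; rewrite w_v.
  by rewrite cardsU1 !inE (negbTE wx).
rewrite add0n; apply: eq_card => u; rewrite !inE.
by case: eqVneq => [->|//]; rewrite w_v !andbF.
Qed.

(** Of [v] and [w], exactly one precedes the other, so exactly one of the two signs changes. *)
Lemma sgn_swap (disp : Order.disp_t) (T : finOrderType disp) (v w : T) (x : {set T}) :
  v != w -> v \notin x -> w \notin x ->
  sgn v x * sgn w (v |: x) = - (sgn w x * sgn v (w |: x)).
Proof.
move=> ne_vw vx wx; rewrite !sgnU1 //.
by case: ltgtP ne_vw => // _ _; rewrite ?expr0 ?expr1; ring.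
Qed.

Lemma bd_lin (disp : Order.disp_t) (T : finOrderType disp)
    (z z' : {set T} -> int) (c : int) y :
  bd (fun x => z x + c * z' x) y = bd z y + c * bd z' y.
Proof.
rewrite /bd mulr_sumr -big_split; apply: eq_bigr => v _ /=.
by rewrite mulrDr mulrCA.
Qed.

Lemma bd_bd (disp : Order.disp_t) (T : finOrderType disp)
    (z : {set T} -> int) : bd (bd z) =1 fun=> 0.
Proof.
move=> y; rewrite /bd.
pose f v w := sgn v y * sgn w (v |: y) * z (w |: (v |: y)).
transitivity (\sum_(v | v \notin y) \sum_(w | (w \notin y) && (v != w)) f v w).
  apply: eq_bigr => v vy; rewrite mulr_sumr; apply: eq_big => [w|w _].
    by rewrite !inE negb_or andbC eq_sym.
  by rewrite /f mulrA.
(* Exchanging the two added vertices reverses the sign of every term. *)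
set S := LHS; suff : S = - S by lia.
rewrite {1}/S (exchange_big_dep (fun w => w \notin y)) /=; last first.
  by move=> v w _ /andP[].
rewrite -sumrN; apply: eq_bigr => w wy; rewrite -sumrN.
apply: eq_big => [v|v /and3P[vy _ ne_vw]]; first by rewrite wy /= eq_sym.
by rewrite /f sgn_swap // setUCA mulNr.
Qed.

Lemma bd_link (disp : Order.disp_t) (T : finOrderType disp) (v : T)
    (z : {set T} -> int) y : bd (link v z) y = - link v (bd z) y.
Proof.
rewrite /link; case: ifPn => vy.
  rewrite oppr0 /bd big1 // => w wy; rewrite !inE vy orbT mulr0 //.
rewrite /bd (bigD1 v) //= !inE eqxx mulr0 add0r mulr_sumr -sumrN /=.
apply: eq_big => [w|w /andP[wy ne_wv]]; first by rewrite !inE negb_or andbC.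
rewrite !inE eq_sym (negbTE ne_wv) (negbTE vy) /= !mulrA.
by rewrite sgn_swap // setUCA mulNr.
Qed.

(** Coning is a contracting homotopy of the full simplex on [T]. *)
Lemma bd_cone (disp : Order.disp_t) (T : finOrderType disp) (v : T)
    (z : {set T} -> int) y : bd (cone v z) y = z y - cone v (bd z) y.
Proof.
rewrite /cone; case: ifPn => vy; last first.
  rewrite /bd (bigD1 v) //= setU11 setU1K // mulrA sgn_sq mul1r.
  rewrite big1 // => w /andP[wy ne_wv].
  by rewrite !inE eq_sym (negbTE ne_wv) (negbTE vy) mulr0.
have vy' : v \notin y :\ v by rewrite setD11.
rewrite -{1 2}(setD1K vy) /bd; set x := y :\ v in vy' *.
rewrite [in RHS](bigD1 v) //= mulrDr mulrA sgn_sq mul1r opprD addrA subrr add0r.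
rewrite mulr_sumr -sumrN /=.
apply: eq_big => [w|w wy]; first by rewrite !inE negb_or andbC.
move: (wy); rewrite in_setU1 negb_or => /andP[ne_wv wx].
rewrite !in_setU1 eqxx orbT.
have -> : (w |: (v |: x)) :\ v = w |: x.
  by rewrite setUCA setU1K // in_setU1 eq_sym negb_or ne_wv vy'.
have : sgn w (v |: x) * sgn v (w |: x) = - (sgn v x * sgn w x).
  rewrite !sgnU1 //; case: ltgtP ne_wv => // _ _; rewrite ?expr0 ?expr1; ring.
by rewrite !mulrA => ->; rewrite mulNr.
Qed.

(** * Cliques and acyclicity *)


(* These are the simplices of dimension m - 1. *)
Definition cliques (T : finType) (e : rel T) (W : {set T}) (m : nat)
  : {set {set T}} :=
  [set x : {set T} | [&& x \subset W,
     [forall u in x, forall v in x, (u != v) ==> e u v] & #|x| == m]].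

Definition chain_on (T : finType) (e : rel T) (W : {set T}) (m : nat)
    (z : {set T} -> int) : Prop :=
  forall x, z x != 0 -> x \in cliques e W m.

(** Vanishing of reduced homology in degree m - 1; for [m = 0] this amounts to [W] being
    nonempty. *)
Definition acyclic (disp : Order.disp_t) (T : finOrderType disp) (e : rel T)
    (W : {set T}) (m : nat) : Prop :=
  forall z : {set T} -> int, chain_on e W m z -> bd z =1 (fun=> 0) ->
  exists2 y : {set T} -> int, chain_on e W m.+1 y & bd y =1 z.

Lemma cliquesP (T : finType) (e : rel T) (W : {set T}) (m : nat) (x : {set T}) :
  reflect [/\ x \subset W, {in x &, forall u v, u != v -> e u v} & #|x| = m]
          (x \in cliques e W m).
Proof.
rewrite inE; apply: (iffP and3P) => -[xW xe /eqP xm]; split=> //.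
  move=> u v ux vx; move/forall_inP/(_ u ux): xe.
  by move/forall_inP/(_ v vx)/implyP.
apply/forall_inP => u ux; apply/forall_inP => v vx; apply/implyP; exact: xe.
Qed.

Lemma cliquesD1 (T : finType) (e : rel T) (W : {set T}) (v : T) m (x : {set T}) :
  (x \in cliques e (W :\ v) m) = (v \notin x) && (x \in cliques e W m).
Proof. by rewrite !inE subsetD1 -!andbA andbCA. Qed.

Lemma cliques_unit_sphere (T : finType) (e : rel T) (W : {set T}) (v : T) m x :
  x \in cliques e (unit_sphere e W v) m -> x \in cliques e W m.
Proof.
case/cliquesP => xS xe xm; apply/cliquesP; split=> //.
by apply: subset_trans xS _; apply/subsetP => u; rewrite inE => /andP[].
Qed.

Lemma notin_unit_sphere (T : finType) (e : rel T) (W : {set T}) (v : T) m x :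
  irreflexive e -> x \in cliques e (unit_sphere e W v) m -> v \notin x.
Proof.
move=> e_irr /cliquesP[/subsetP xS _ _]; apply/negP => /xS.
by rewrite inE e_irr andbF.
Qed.

Lemma cliquesU1 (T : finType) (e : rel T) (W : {set T}) (v : T) m (x : {set T}) :
  symmetric e -> v \notin x ->
  (v |: x \in cliques e W m.+1) =
  (v \in W) && (x \in cliques e (unit_sphere e W v) m).
Proof.
move=> e_sym vx; apply/cliquesP/andP => [[]|[vW /cliquesP[/subsetP xS xe xm]]].
  rewrite subUset sub1set cardsU1 vx => /andP[vW /subsetP xW] xe [xm].
  split=> //; apply/cliquesP; split=> // [|u w ux wx].
    apply/subsetP => u ux; rewrite inE xW // xe ?inE ?eqxx ?ux ?orbT //.
    by apply: contraNneq vx => ->.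
  by apply: xe; rewrite inE ?ux ?wx orbT.
split; last by rewrite cardsU1 vx xm.
  rewrite subUset sub1set vW; apply/subsetP => u /xS.
  by rewrite inE => /andP[].
move=> u w; rewrite !inE => /predU1P[->|ux] /predU1P[->|wx] ne_uw.
- by rewrite eqxx in ne_uw.
- by have := xS w wx; rewrite inE => /andP[].
- by rewrite e_sym; have := xS u ux; rewrite inE => /andP[].
exact: xe.
Qed.

Lemma cliques_facet (T : finType) (e : rel T) (W : {set T}) (v : T) m (x : {set T}) :
  v \notin x -> v |: x \in cliques e W m.+1 -> x \in cliques e W m.
Proof.
move=> vx /cliquesP[]; rewrite subUset cardsU1 vx => /andP[_ xW] xe [xm].
apply/cliquesP; split=> // u w ux wx.
by apply: xe; rewrite inE ?ux ?wx orbT.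
Qed.

Lemma cliques0 (T : finType) (e : rel T) (W x : {set T}) :
  (x \in cliques e W 0) = (x == set0).
Proof.
apply/cliquesP/eqP => [[_ _ /eqP]|->]; first by rewrite cards_eq0 => /eqP.
by rewrite cards0 sub0set; split=> // u v; rewrite inE.
Qed.

Lemma cliques1P (T : finType) (e : rel T) (W x : {set T}) :
  reflect (exists2 v, v \in W & x = [set v]) (x \in cliques e W 1).
Proof.
apply: (iffP (cliquesP _ _ _ _)) => [[xW _ /eqP/cards1P[v defx]]|[v vW ->]].
  by exists v => //; move: xW; rewrite defx sub1set.
rewrite sub1set vW cards1; split=> // u w; rewrite !inE => /eqP-> /eqP->.
by rewrite eqxx.
Qed.

Lemma chain_on0 (T : finType) (e : rel T) (W : {set T}) m z x :
  chain_on e W m z -> x \notin cliques e W m -> z x = 0.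
Proof. by move=> zW xW; apply/eqP; apply: contraNT xW => /zW. Qed.

Lemma chain_on_lin (T : finType) (e : rel T) (W : {set T}) m z z' (c : int) :
  chain_on e W m z -> chain_on e W m z' ->
  chain_on e W m (fun x => z x + c * z' x).
Proof.
move=> zW z'W x; apply: contraR => xW.
by rewrite (chain_on0 zW) // (chain_on0 z'W) // mulr0 addr0.
Qed.

Lemma chain_on_bd (disp : Order.disp_t) (T : finOrderType disp) (e : rel T)
    (W : {set T}) m (z : {set T} -> int) :
  chain_on e W m.+1 z -> chain_on e W m (bd z).
Proof.
move=> zW y; apply: contraR => yW; rewrite /bd big1 // => v vy.
by rewrite (chain_on0 zW) ?mulr0 //; apply: contra yW => /(cliques_facet vy).
Qed.

Lemma chain_on_link (disp : Order.disp_t) (T : finOrderType disp) (e : rel T)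
    (W : {set T}) m (v : T) (z : {set T} -> int) :
  symmetric e ->
  chain_on e W m.+1 z -> chain_on e (unit_sphere e W v) m (link v z).
Proof.
move=> e_sym zW y; rewrite /link; case: ifPn; rewrite ?eqxx // => vy.
by rewrite mulf_eq0 negb_or => /andP[_ /zW]; rewrite cliquesU1 // => /andP[].
Qed.

Lemma chain_on_cone (disp : Order.disp_t) (T : finOrderType disp) (e : rel T)
    (W : {set T}) m (v : T) (z : {set T} -> int) :
  symmetric e -> v \in W ->
  chain_on e (unit_sphere e W v) m z -> chain_on e W m.+1 (cone v z).
Proof.
move=> e_sym vW zS x; rewrite /cone; case: ifPn; rewrite ?eqxx // => vx.
rewrite mulf_eq0 negb_or => /andP[_ /zS].
by rewrite -{2}(setD1K vx) cliquesU1 ?setD11 // vW.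
Qed.

Lemma chain_onD1 (T : finType) (e : rel T) (W : {set T}) m v z :
  chain_on e (W :\ v) m z -> chain_on e W m z.
Proof. by move=> zS x /zS; rewrite cliquesD1 => /andP[]. Qed.

Lemma chain_on_setD1 (disp : Order.disp_t) (T : finOrderType disp) (e : rel T)
    (W : {set T}) m v (z : {set T} -> int) :
  chain_on e W m z -> link v z =1 (fun=> 0) -> chain_on e (W :\ v) m z.
Proof.
move=> zW z_v x zx; rewrite cliquesD1 zW // andbT; apply: contra zx => vx.
have := z_v (x :\ v); rewrite /link setD11 setD1K // => /eqP.
by rewrite mulf_eq0 /sgn signr_eq0.
Qed.

Lemma link_cone (disp : Order.disp_t) (T : finOrderType disp) (v : T)
    (z : {set T} -> int) y :
  link v (cone v z) y = if v \in y then 0 else z y.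
Proof.
rewrite /link /cone; case: ifPn => // vy.
by rewrite setU11 setU1K // mulrA sgn_sq mul1r.
Qed.

Lemma link_lin (disp : Order.disp_t) (T : finOrderType disp) (v : T)
    (z z' : {set T} -> int) (c : int) y :
  link v (fun x => z x + c * z' x) y = link v z y + c * link v z' y.
Proof.
rewrite /link; case: ifP => _; first by rewrite mulr0 addr0.
by rewrite mulrDr mulrCA.
Qed.

(** Mayer-Vietoris on chains: the link of a cycle bounds some [a] in the unit sphere. Adding the
    boundary of the cone over [a] pushes the cycle off [v], where it bounds. *)
Lemma acyclic_cone (disp : Order.disp_t) (T : finOrderType disp) (e : rel T)
    (W : {set T}) v m :
  symmetric e -> irreflexive e -> v \in W ->
  acyclic e (unit_sphere e W v) m -> acyclic e (W :\ v) m.+1 ->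
  acyclic e W m.+1.
Proof.
move=> e_sym e_irr vW acycS acycD z zW z_cyc.
have [y|a aS bd_a] := acycS _ (chain_on_link (v := v) e_sym zW).
  by rewrite bd_link /link z_cyc mulr0 if_same oppr0.
have aC := chain_on_cone e_sym vW aS.
(* The boundary of the cone is [a - cone v (link v z)], and [a] avoids [v], so the links cancel. *)
have z'_v : link v (fun x => z x + 1 * bd (cone v a) x) =1 (fun=> 0).
  move=> y; rewrite link_lin mul1r; case vy: (v \in y).
    by rewrite /link vy addr0.
  rewrite [link v (bd _) y]/link vy bd_cone /cone setU11 setU1K ?vy // bd_a.
  rewrite (chain_on0 aS) ?sub0r ?mulrN ?mulrA ?sgn_sq ?mul1r ?subrr //.
  by apply/negP => /(notin_unit_sphere e_irr); rewrite setU11.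
have z'D := chain_on_setD1 (chain_on_lin zW (chain_on_bd aC)) z'_v.
have [y|b bD bd_b] := acycD _ z'D.
  by rewrite bd_lin z_cyc bd_bd mulr0 addr0.
exists (fun x => b x + -1 * cone v a x).
  exact: chain_on_lin (chain_onD1 bD) aC.
by move=> y; rewrite bd_lin bd_b mul1r mulN1r addrK.
Qed.

Lemma acyclic_setD1_0 (disp : Order.disp_t) (T : finOrderType disp) (e : rel T)
    (W : {set T}) v : acyclic e (W :\ v) 0 -> acyclic e W 0.
Proof.
move=> acycD z zW z_cyc; have [|y yD bd_y] := acycD z _ z_cyc.
  by move=> x /zW; rewrite !cliques0.
by exists y => //; apply: chain_onD1 yD.
Qed.

Lemma contractible_acyclic (disp : Order.disp_t) (T : finOrderType disp)
    (e : rel T) (W : {set T}) m :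
  symmetric e -> irreflexive e -> contractible e W -> acyclic e W m.
Proof.
move=> e_sym e_irr cW; elim: cW m => [v|{}W v vW _ acS _ acD] [|m].
- move=> z zW z_cyc; exists (cone v z); last first.
    by move=> y; rewrite bd_cone /cone z_cyc mulr0 if_same subr0.
  apply: chain_on_cone; rewrite ?set11 //.
  by move=> x /zW; rewrite !cliques0.
(* On a single vertex only [[set v]] can carry a nonzero value, which the boundary at the empty set
   detects. *)
- move=> z zW z_cyc; suff z0 : z =1 (fun=> 0).
    exists (fun=> 0) => [x|y]; first by rewrite eqxx.
    by rewrite z0 /bd big1 // => w _; rewrite mulr0.
  move=> x; apply/eqP; apply: contraT => zx.
  have /cliquesP[xv _ xm] := zW _ zx.
  have defx : x = [set v].
    by apply/eqP; rewrite eqEcard xv cards1 xm.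
  have := z_cyc set0; rewrite /bd (bigD1 v) ?inE //= setU0 -defx.
  rewrite big1 => [|w /andP[_ ne_wv]].
    by rewrite addr0 => /eqP; rewrite mulf_eq0 (negbTE zx) /sgn signr_eq0.
  rewrite (chain_on0 zW) ?mulr0 //; apply/negP => /cliquesP[].
  by rewrite setU0 sub1set inE (negbTE ne_wv).
- exact: acyclic_setD1_0 (acD 0%N).
exact: acyclic_cone (acS m) (acD m.+1).
Qed.

(** * Spheres *)


Lemma contractible_neq0 (T : finType) (e : rel T) (W : {set T}) :
  contractible e W -> exists v, v \in W.
Proof. by case=> [v|{}W v vW _ _]; exists v; rewrite ?set11. Qed.

(* [D] is one more than the dimension; [sigma] is a fundamental cycle. *)
Definition sphere_like (disp : Order.disp_t) (T : finOrderType disp)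
    (e : rel T) (D : nat) (W : {set T}) : Prop :=
  [/\ forall m x, x \in cliques e W m -> (m <= D)%N,
      forall m, (m < D)%N -> acyclic e W m,
      exists x, x \in cliques e W D,
      forall w, w \in W -> exists2 x, x \in cliques e W D & w \in x
    & exists sigma : {set T} -> int,
      [/\ chain_on e W D sigma, bd sigma =1 (fun=> 0),
          forall x, x \in cliques e W D -> `|sigma x| = 1
        & forall z, chain_on e W D z -> bd z =1 (fun=> 0) ->
            exists c, z =1 (fun x => c * sigma x)]].

(** Connectedness without paths: [W :\ v] is connected by induction, and [v] has a neighbour there
    because its unit sphere is nonempty. *)
Lemma contractible_connected (T : finType) (e : rel T) (W A : {set T}) :
  symmetric e -> irreflexive e ->
  contractible e W -> (exists2 u, u \in W & u \in A) ->
  (forall u w, u \in W -> w \in W -> u \in A -> e u w -> w \in A) ->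
  W \subset A.
Proof.
move=> e_sym e_irr cW.
elim: cW A => [v|{}W v vW cS _ cD IH] A [u uW uA] Acl.
  by move: uW uA; rewrite inE => /eqP->; rewrite sub1set.
have [w] := contractible_neq0 cS; rewrite inE => /andP[wW e_vw].
have wD : w \in W :\ v.
  by rewrite !inE wW andbT; apply: contraTneq e_vw => ->; rewrite e_irr.
have DA x : x \in W :\ v -> x \in A -> W :\ v \subset A.
  move=> xD xA; apply: IH; first by exists x.
  by move=> x' y /setD1P[_ x'W] /setD1P[_ yW]; apply: Acl.
have subA : W :\ v \subset A.
  have [uv|ne_uv] := eqVneq u v; last by apply: (DA u); rewrite // !inE ne_uv.
  by apply: (DA w) => //; apply: (Acl v) => //; rewrite -uv.
rewrite -(setD1K vW) subUset sub1set subA andbT.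
by apply: (Acl w) => //; rewrite 1?e_sym // (subsetP subA).
Qed.

Lemma chain_on_cst0 (T : finType) (e : rel T) (W : {set T}) m z :
  (forall x, x \notin cliques e W m) -> chain_on e W m z -> z =1 (fun=> 0).
Proof. by move=> W0 zW x; apply: chain_on0 zW _; apply: W0. Qed.

Lemma bd_cst0 (disp : Order.disp_t) (T : finOrderType disp)
    (z : {set T} -> int) : z =1 (fun=> 0) -> bd z =1 (fun=> 0).
Proof. by move=> z0 y; rewrite /bd big1 // => v _; rewrite z0 mulr0. Qed.

Lemma norm_link (disp : Order.disp_t) (T : finOrderType disp) (v : T)
    (z : {set T} -> int) (x : {set T}) : v \in x -> `|link v z (x :\ v)| = `|z x|.
Proof.
by move=> vx; rewrite /link setD11 setD1K // normrM /sgn normr_sign mul1r.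
Qed.

Lemma link_cycle (disp : Order.disp_t) (T : finOrderType disp) (v : T)
    (z : {set T} -> int) : bd z =1 (fun=> 0) -> bd (link v z) =1 (fun=> 0).
Proof. by move=> z0 y; rewrite bd_link /link z0 mulr0 if_same oppr0. Qed.

Lemma sphere_like_set0 (disp : Order.disp_t) (T : finOrderType disp)
    (e : rel T) : sphere_like e 0 (set0 : {set T}).
Proof.
have cl0 m (x : {set T}) : x \in cliques e set0 m -> (m = 0%N) * (x = set0).
  move=> /cliquesP[]; rewrite subset0 => /eqP-> _; rewrite cards0 => <-.
  by split.
split=> //.
- by move=> m x /cl0 ->.
- by exists set0; rewrite cliques0.
- by move=> w; rewrite inE.
exists (fun x => (x == set0)%:R); split.
- by move=> x; rewrite cliques0; case: (x == set0).
- move=> y; rewrite /bd big1 // => v _; case: eqP => [/setP/(_ v)|_].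
    by rewrite !inE eqxx.
  by rewrite mulr0.
- by move=> x /cl0[_ ->]; rewrite eqxx normr1.
move=> z zW _; exists (z set0) => x; case: eqP => [->|ne_x0]; first by rewrite mulr1.
by rewrite mulr0 (chain_on0 zW) // cliques0; apply/eqP.
Qed.

(** A sphere is a cone over S(v0) glued to the acyclic complement of v0, so the fundamental cycle of
    S(v0) suspends to one of [W]. *)
Lemma sphere_like_step (disp : Order.disp_t) (T : finOrderType disp)
    (e : rel T) (D : nat) (W : {set T}) (v0 : T) :
  symmetric e -> irreflexive e ->
  (forall v, v \in W -> sphere_like e D (unit_sphere e W v)) ->
  v0 \in W -> contractible e (W :\ v0) -> sphere_like e D.+1 W.
Proof.
move=> e_sym e_irr sphS v0W cD.
have dimW m x : x \in cliques e W m -> (m <= D.+1)%N.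
  case: m => // m; have [->|[v vx]] := set_0Vmem x.
    by move=> /cliquesP[_ _]; rewrite cards0.
  rewrite -(setD1K vx) cliquesU1 ?setD11 // => /andP[vW].
  by have [dimS _ _ _ _] := sphS v vW; apply: dimS.
have acD m : acyclic e (W :\ v0) m by exact: contractible_acyclic cD.
have [dimS0 acS0 [y0 y0S] pureS0 [a [aS a_cyc a1 a_gen]]] := sphS v0 v0W.
have aD : chain_on e (W :\ v0) D a.
  move=> x /aS xS; rewrite cliquesD1 (notin_unit_sphere e_irr xS).
  exact: cliques_unit_sphere xS.
have [b bD bd_b] := acD D a aD a_cyc.
(* Both the cone and [b] fill [a], so their difference is a cycle. *)
pose sigma x := cone v0 a x + -1 * b x.
have sigmaW : chain_on e W D.+1 sigma.
  by apply: chain_on_lin; [apply: chain_on_cone | apply: chain_onD1 bD].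
have sigma_cyc : bd sigma =1 (fun=> 0).
  move=> y; rewrite bd_lin bd_cone bd_b mulN1r addrAC subrr add0r.
  by rewrite /cone a_cyc mulr0 if_same oppr0.
have link_sigma : link v0 sigma =1 a.
  move=> y; rewrite link_lin link_cone; case: ifPn => v0y.
    rewrite /link v0y mulr0 addr0 (chain_on0 aS) //.
    by apply: contraL v0y; apply: notin_unit_sphere.
  rewrite /link (negbTE v0y) (chain_on0 bD) ?mulr0 ?addr0 //.
  by rewrite cliquesD1 setU11.
(* Subtracting the multiple of [sigma] with the same link at v0 leaves a cycle in the acyclic
   complement; it bounds a chain above the top dimension, hence is zero. *)
have sigma_gen z : chain_on e W D.+1 z -> bd z =1 (fun=> 0) ->
    exists c, z =1 (fun x => c * sigma x).
  move=> zW z_cyc.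
  have [c def_c] := a_gen _ (chain_on_link (v := v0) e_sym zW) (link_cycle _ z_cyc).
  exists c => x.
  have tauD : chain_on e (W :\ v0) D.+1 (fun x => z x + - c * sigma x).
    apply: chain_on_setD1; first exact: chain_on_lin.
    by move=> y; rewrite link_lin def_c link_sigma mulNr subrr.
  have [y|t tD bd_t] := acD D.+1 _ tauD.
    by rewrite bd_lin z_cyc sigma_cyc mulr0 addr0.
  have /bd_cst0/(_ x) : t =1 (fun=> 0).
    apply: chain_on_cst0 tD => x'; rewrite cliquesD1 negb_and negbK.
    by apply/orP; right; apply/negP => /dimW; rewrite ltnn.
  by rewrite bd_t mulNr => /eqP; rewrite subr_eq0 => /eqP.
split=> //.
- case=> [_|m m_D]; first exact: acyclic_setD1_0 (acD 0%N).
  by apply: (acyclic_cone e_sym e_irr v0W) => //; apply: acS0.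
- by exists (v0 |: y0); rewrite cliquesU1 ?v0W // (notin_unit_sphere e_irr y0S).
- move=> w wW; have [_ _ [y yS] _ _] := sphS w wW; exists (w |: y); last exact: setU11.
  by rewrite cliquesU1 ?wW // (notin_unit_sphere e_irr yS).
exists sigma; split=> //.
(* [sigma] is +-1 on the facets at v0.  At an adjacent vertex w its link is a
   multiple of the fundamental cycle of S(w), and a facet containing the edge
   shows that the factor is +-1; connectedness spreads this to every vertex. *)
pose A := [set v | [forall x in cliques e W D.+1, (v \in x) ==> (`|sigma x| == 1)]].
have inA v : reflect
    (forall x, x \in cliques e W D.+1 -> v \in x -> `|sigma x| = 1) (v \in A).
  rewrite inE; apply: (iffP forall_inP) => sA x xW.
    by move=> vx; have /implyP/(_ vx)/eqP := sA x xW.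
  by apply/implyP => vx; rewrite sA.
have v0A : v0 \in A.
  apply/inA => x xW v0x; rewrite -(norm_link sigma v0x) link_sigma a1 //.
  by move: xW; rewrite -{1}(setD1K v0x) cliquesU1 ?setD11 // v0W.
have A_closed v w : v \in W -> w \in W -> v \in A -> e v w -> w \in A.
  move=> vW wW /inA vA e_vw.
  have wS : w \in unit_sphere e W v by rewrite inE wW.
  have [_ _ _ /(_ w wS)[y yS wy] _] := sphS v vW.
  have vy := notin_unit_sphere e_irr yS.
  have xW : v |: y \in cliques e W D.+1 by rewrite cliquesU1 ?vW.
  have wx : w \in v |: y by rewrite inE wy orbT.
  have [_ _ _ _ [sw [_ _ sw1 sw_gen]]] := sphS w wW.
  have [c def_c] := sw_gen _ (chain_on_link e_sym sigmaW) (link_cycle _ sigma_cyc).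
  have sigma_c x : x \in cliques e W D.+1 -> w \in x -> `|sigma x| = `|c|.
    move=> {}xW {}wx; rewrite -(norm_link sigma wx) def_c normrM sw1 ?mulr1 //.
    by move: xW; rewrite -{1}(setD1K wx) cliquesU1 ?setD11 // wW.
  by apply/inA => x x_W w_x; rewrite sigma_c // -(sigma_c _ xW wx) vA // setU11.
(* Connectedness is known only away from v0, so a second starting vertex is required: a neighbour of
   v0, or for the 0-sphere the other point, where the vanishing augmentation gives the same absolute
   value. *)
have [u uD uA] : exists2 u, u \in W :\ v0 & u \in A.
  have [D0|D_gt0] := posnP D; last first.
    have /card_gt0P[u uy] : (0 < #|y0|)%N by have /cliquesP[_ _ ->] := y0S.
    have /cliquesP[/subsetP/(_ u uy)] := y0S; rewrite inE => /andP[uW e_v0u] _ _.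
    exists u; last exact: A_closed v0W uW v0A e_v0u.
    by rewrite !inE uW andbT; apply: contraTneq e_v0u => ->; rewrite e_irr.
  have noedge v w : v \in W -> w \in W -> e v w -> False.
    move=> vW wW e_vw; have [dimS _ _ _ _] := sphS v vW.
    have /dimS : [set w] \in cliques e (unit_sphere e W v) 1.
      by apply/cliques1P; exists w => //; rewrite inE wW.
    by rewrite D0.
  have [u uD] := contractible_neq0 cD; exists u => //.
  have /setD1P[ne_uv0 uW] := uD.
  have sub_u : W :\ v0 \subset [set u].
    apply: (contractible_connected e_sym e_irr cD).
      by exists u; rewrite ?set11.
    by move=> v w /setD1P[_ vW] /setD1P[_ wW] _ /(noedge v w vW wW).
  have := sigma_cyc set0; rewrite /bd (bigD1 v0) ?in_set0 //= (bigD1 u) ?in_set0 //=.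
  rewrite big1 ?addr0 => [|w /andP[/andP[_ ne_wv0] ne_wu]]; last first.
    rewrite (chain_on0 sigmaW) ?mulr0 //; rewrite D0 setU0.
    apply/cliques1P => -[w' w'W /set1_inj ww']; subst w'.
    have /(subsetP sub_u) : w \in W :\ v0 by rewrite !inE ne_wv0.
    by rewrite inE (negbTE ne_wu).
  rewrite !setU0 => /eqP; rewrite addr_eq0 => /eqP/(congr1 Num.norm).
  rewrite normrN !normrM /sgn !normr_sign !mul1r => sigma_uv0.
  apply/inA => x; rewrite D0 => /cliques1P[w wW ->]; rewrite inE => /eqP <-.
  have /inA v0_1 := v0A; rewrite -sigma_uv0 v0_1 ?set11 // D0.
  by apply/cliques1P; exists v0.
have sub_A : W :\ v0 \subset A.
  apply: (contractible_connected e_sym e_irr cD); first by exists u.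
  by move=> v w /setD1P[_ vW] /setD1P[_ wW]; apply: A_closed.
move=> x xW; have /card_gt0P[v vx] : (0 < #|x|)%N by have /cliquesP[_ _ ->] := xW.
have vW : v \in W by have /cliquesP[/subsetP/(_ v vx)] := xW.
have : v \in A.
  by have [->//|ne] := eqVneq v v0; apply: (subsetP sub_A); rewrite !inE ne.
by move/inA; apply.
Qed.

Lemma sphere_sphere_like (disp : Order.disp_t) (T : finOrderType disp)
    (e : rel T) (k : int) (W : {set T}) :
  symmetric e -> irreflexive e -> sphere e k W ->
  exists2 D : nat, k = D%:Z - 1 & sphere_like e D W.
Proof.
move=> e_sym e_irr; elim=> [|{}k {}W k_ge0 _ IH [v0 v0W cD]].
  by exists 0%N => //; apply: sphere_like_set0.
exists `|k|%N.+1; first by lia.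
apply: (sphere_like_step (v0 := v0)) => // v /IH[D kD].
by have -> : D = `|k|%N by lia.
Qed.

(** Otherwise the fundamental cycle would bound a chain above the top dimension, hence vanish. This
    settles which branch [phi] takes. *)
Lemma sphere_not_contractible (disp : Order.disp_t) (T : finOrderType disp)
    (e : rel T) (D : nat) (W : {set T}) :
  symmetric e -> irreflexive e -> sphere_like e D W -> ~ contractible e W.
Proof.
move=> e_sym e_irr [dimW _ [x xW] _ [sigma [sW s_cyc s1 _]]] cW.
have [y yW bd_y] := contractible_acyclic e_sym e_irr cW sW s_cyc.
have /bd_cst0/(_ x) : y =1 (fun=> 0).
  by apply: chain_on_cst0 yW => x'; apply/negP => /dimW; rewrite ltnn.
by rewrite bd_y => s0; have := s1 x xW; rewrite s0 normr0.
Qed.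

(** * From chains to matrices *)


(* The integer form of [incidence]. *)
Definition inc (disp : Order.disp_t) (T : finOrderType disp)
    (y x : {set T}) : int := bd (fun x' => (x' == x)%:R) y.

Lemma inc_neq0 (disp : Order.disp_t) (T : finOrderType disp) (y x : {set T}) :
  inc y x != 0 -> y \subset x /\ #|x| = #|y|.+1.
Proof.
rewrite /inc /bd => inc_nz.
have [v /andP[vy /eqP<-]|no_v] := pickP (fun v => (v \notin y) && (v |: y == x)).
  by rewrite subsetUr cardsU1 vy.
move: inc_nz; rewrite big1 ?eqxx // => v vy.
by have := no_v v; rewrite vy /= => ->; rewrite mulr0.
Qed.

Lemma bd_inc (disp : Order.disp_t) (T : finOrderType disp)
    (z : {set T} -> int) y : bd z y = \sum_x z x * inc y x.
Proof.
under eq_bigr do rewrite /inc /bd mulr_sumr.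
rewrite exchange_big; apply: eq_bigr => v vy /=.
rewrite (bigD1 (v |: y)) //= big1 => [|x ne_x]; last first.
  by rewrite eq_sym (negbTE ne_x) !mulr0.
by rewrite eqxx mulr1 addr0 mulrC.
Qed.

Lemma incidence_inc (C : numClosedFieldType) (disp : Order.disp_t)
    (T : finOrderType disp) (y x : {set T}) : incidence C y x = (inc y x)%:~R.
Proof.
rewrite /incidence /inc /bd rmorph_sum /=.
rewrite [RHS](bigID (fun v => v |: y == x)) /= [X in _ + X]big1 ?addr0; last first.
  by move=> v /andP[_ /negbTE ->]; rewrite mulr0.
apply: eq_big => [v|v /andP[vx /eqP ->]].
  apply/andP/andP => -[]; first by move=> vx /eqP ->; rewrite setD11 setD1K.
  by move=> vy /eqP <-; rewrite setU11 setU1K.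
rewrite setD1K // eqxx mulr1 /sgn rmorphXn rmorphN1; congr (_ ^+ _).
apply: eq_card => w; rewrite !inE.
by case: eqVneq => [->|//]; rewrite ltxx andbF.
Qed.

(** Boundaries are tested only on kept simplices. When [set0] is not in [S], the cycle condition is
    void for [m = 0], so every kept 0-chain has to bound. *)
Definition exact_on (disp : Order.disp_t) (T : finOrderType disp)
    (S : {set {set T}}) : Prop :=
  forall m (z : {set T} -> int),
    (forall x, z x != 0 -> x \in S /\ #|x| = m.+1) ->
    (forall y, y \in S -> #|y| = m -> bd z y = 0) ->
  exists2 t : {set T} -> int,
    forall x, t x != 0 -> x \in S /\ #|x| = m.+2 &
    forall x, x \in S -> #|x| = m.+1 -> bd t x = z x.

Section Exact.

Variables (disp : Order.disp_t) (T : finOrderType disp) (S : {set {set T}}).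
(** [f k] lists the kept simplices of dimension [k] in an arbitrary order, so that any indexing of
    the blocks fits. *)
Variables (n : nat -> nat) (f : forall k, 'I_(n k) -> {set T}).
Hypothesis f_inj : forall k, injective (@f k).
Hypothesis f_im : forall k x,
  reflect (exists i : 'I_(n k), x = f i) ((x \in S) && (#|x| == k.+1)).

Let E k : 'M[int]_(n k.+1, n k) := \matrix_(i, j) inc (f j) (f i).

Lemma kept_card k (i : 'I_(n k)) : f i \in S /\ #|f i| = k.+1.
Proof. by have /f_im/andP[? /eqP] : exists j : 'I_(n k), f i = f j by exists i. Qed.

Lemma sum_kept k (F : {set T} -> int) :
  (forall x, F x != 0 -> x \in S /\ #|x| = k.+1) ->
  \sum_x F x = \sum_(i < n k) F (f i).
Proof.
move=> F_S; rewrite -(big_imset _ (in2W (@f_inj k))) /=.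
rewrite [LHS](bigID [in (@f k) @: 'I_(n k)]) /= [X in _ + X]big1 ?addr0 // => x.
apply: contraNeq => /F_S[xS xk].
have /f_im[i ->] : (x \in S) && (#|x| == k.+1) by rewrite xS xk eqxx.
exact: imset_f.
Qed.

Lemma mul_row_boundary k (t : {set T} -> int) (y : 'rV_(n k.+1)) j :
  (forall x, t x != 0 -> x \in S /\ #|x| = k.+2) ->
  (forall i, y 0 i = t (f i)) -> (y *m E k) 0 j = bd t (f j).
Proof.
move=> t_S y_t; rewrite mxE bd_inc (@sum_kept k.+1) => [|x]; last first.
  by rewrite mulf_eq0 negb_or => /andP[/t_S].
by apply: eq_bigr => i _; rewrite y_t mxE.
Qed.

Definition chain_row k (z : 'rV[int]_(n k)) (x : {set T}) : int :=
  \sum_i z 0 i * (f i == x)%:R.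

Lemma chain_rowE k (z : 'rV_(n k)) i : chain_row z (f i) = z 0 i.
Proof.
rewrite /chain_row (bigD1 i) //= eqxx mulr1 big1 ?addr0 // => j ne_ji.
by rewrite (inj_eq (@f_inj k)) (negbTE ne_ji) mulr0.
Qed.

Lemma chain_row_kept k (z : 'rV_(n k)) x :
  chain_row z x != 0 -> x \in S /\ #|x| = k.+1.
Proof.
have [i /eqP <- _|no_i] := pickP (fun i : 'I_(n k) => f i == x); first exact: kept_card.
by rewrite /chain_row big1 ?eqxx // => i _; rewrite no_i mulr0.
Qed.

Hypothesis S0 : set0 \notin S.
(* Convexity keeps e_(k+1) e_k = 0 after the deletion. *)
Hypothesis S_convex : forall w x y : {set T}, w \in S -> x \in S ->
  w \subset y -> y \subset x -> y \in S.
Hypothesis S_exact : exact_on S.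

Lemma boundary_comp0 k : E k.+1 *m E k = 0.
Proof.
apply/matrixP => i j; rewrite [RHS]mxE mxE.
have [fiS fik] := kept_card i; have [fjS fjk] := kept_card j.
rewrite -[RHS](bd_bd (fun x => (x == f i)%:R) (f j)) bd_inc (@sum_kept k.+1).
  by apply: eq_bigr => l _; rewrite !mxE.
move=> x; rewrite mulf_eq0 negb_or => /andP[/inc_neq0[xi _] /inc_neq0[jx xk]].
by rewrite xk fjk (S_convex fjS fiS jx xi).
Qed.

Lemma boundary_exact k (z : 'rV_(n k.+1)) : z *m E k = 0 -> exists y, z = y *m E k.+1.
Proof.
move=> zE; have [y yS yk|t t_S bd_t] := S_exact (@chain_row_kept _ z).
  have /f_im[j ->] : (y \in S) && (#|y| == k.+1) by rewrite yS yk eqxx.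
  rewrite -(mul_row_boundary (y := z) (k := k)) ?zE ?mxE //; first exact: chain_row_kept.
  by move=> i; rewrite chain_rowE.
exists (\row_i t (f i)); apply/rowP => j; rewrite (mul_row_boundary (t := t)) //.
  by have [jS jk] := kept_card j; rewrite bd_t // chain_rowE.
by move=> i; rewrite mxE.
Qed.

Lemma prod_pdet_incidence (C : numClosedFieldType) (N : nat) :
  n N.+1 = 0%N ->
  \prod_(k < N)
    (let ek : 'M[C]_(n k.+1, n k) := \matrix_(i, j) incidence C (f j) (f i) in
     pdet (ek^t* *m ek)%sesqui ^ ((-1) ^+ k)) = 1.
Proof.
move=> nN; rewrite -[RHS](prod_pdet_exact C boundary_comp0 _ boundary_exact nN) => [|z].
  apply: eq_bigr => k _ /=.
  suff -> : \matrix_(i, j) incidence C (f j) (f i) = map_mx intr (E k) by [].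
  by apply/matrixP => i j; rewrite !mxE incidence_inc.
have [y yS /eqP|t t_S bd_t] := S_exact (@chain_row_kept _ z).
  by rewrite cards_eq0 => /eqP y0; move: S0; rewrite -y0 yS.
exists (\row_i t (f i)); apply/rowP => j; rewrite (mul_row_boundary (t := t)) //.
  by have [jS jk] := kept_card j; rewrite bd_t // chain_rowE.
by move=> i; rewrite mxE.
Qed.

End Exact.

Lemma SDet_exact (C : numClosedFieldType) (disp : Order.disp_t)
    (T : finOrderType disp) (n : nat) (s : n.-tuple {set T}) (K : {set 'I_n}) :
  let S := [set tnth s i | i in K] in
  uniq s -> set0 \notin S ->
  (forall w x y : {set T}, w \in S -> x \in S ->
     w \subset y -> y \subset x -> y \in S) ->
  exact_on S ->
  SDet (@kept_dim T n s K) (principal K (dirac C s)) = 1.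
Proof.
move=> S s_uniq S0 S_convex S_exact; set g := kept_dim s (K := K).
(* The inner [enum_val] selects a kept index of dimension [k], the outer one its position in [s]. *)
pose f (k : nat) (i : 'I_#|[set i | g i == k]|) := tnth s (enum_val (enum_val i)).
have tnth_inj : injective (tnth s) by apply/tuple_uniqP.
have f_inj (k : nat) : injective (@f k).
  by move=> i j /tnth_inj/enum_val_inj/enum_val_inj.
have f_im (k : nat) x : reflect (exists i, x = @f k i) ((x \in S) && (#|x| == k.+1)).
  apply: (iffP andP) => [[/imsetP[i iK ->] /eqP xk]|[i ->]].
    have gi : enum_rank_in iK i \in [set i | g i == k].
      by rewrite inE /g /kept_dim enum_rankK_in // /Defs.dim xk.
    by exists (enum_rank_in gi (enum_rank_in iK i)); rewrite /f !enum_rankK_in.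
  have fS : f k i \in S by apply: imset_f; apply: enum_valP.
  (* [dim] truncates at 0, so the absence of the empty set is what gives cardinality [k.+1]. *)
  split=> //; have := enum_valP i; rewrite inE /g /kept_dim /Defs.dim -/(f k i).
  move/eqP=> fk; rewrite -[X in _ == X.+1]fk prednK // card_gt0.
  by apply: contraNneq S0 => <-.
rewrite /SDet -[RHS](prod_pdet_incidence f_inj f_im S0 S_convex S_exact C
  (N := \max_i g i)).
  apply: eq_bigr => k _ /=; rewrite degree_block_principal_dirac.
  suff -> : degree_block g (principal K (ext_derivative C s)) k.+1 k =
            \matrix_(i, j) incidence C (f k j) (f k.+1 i) by [].
  by apply/matrixP => i j; rewrite !mxE.
apply/eqP; rewrite cards_eq0; apply/eqP/setP => i; rewrite !inE.
by apply/negP => /eqP gi; have := @leq_bigmax _ g i; rewrite gi ltnn.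
Qed.

(** * Exactness after deleting a vertex and a facet *)

Lemma bd_set0 (disp : Order.disp_t) (T : finOrderType disp)
    (z : {set T} -> int) (v : T) :
  (forall w, w != v -> z [set w] = 0) -> bd z set0 = z [set v].
Proof.
move=> z0; rewrite /bd (bigD1 v) ?in_set0 //= setU0 big1 ?addr0.
  have -> : sgn v set0 = 1; last by rewrite mul1r.
  by rewrite /sgn (_ : [set w in set0 | _] = set0) ?cards0 //; apply/setP => w; rewrite !inE.
by move=> w /andP[_ ne_wv]; rewrite setU0 z0 ?mulr0.
Qed.

(** A relative cycle becomes a genuine one by changing at most its value at the deleted vertex. For
    0-chains a multiple of [[set v]] corrects the augmentation; in higher degrees no change is
    made. *)
Lemma lift_cycle (disp : Order.disp_t) (T : finOrderType disp) (e : rel T)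
    (W : {set T}) (v : T) m (z : {set T} -> int) :
  v \in W -> chain_on e W m.+1 z ->
  (forall y, y \in cliques e W m -> y != set0 -> y != [set v] -> bd z y = 0) ->
  exists z' : {set T} -> int,
    [/\ chain_on e W m.+1 z', bd z' =1 (fun=> 0)
      & forall x, x != [set v] -> z' x = z x].
Proof.
move=> vW zW bd_z; case: m zW bd_z => [|m] zW bd_z.
  pose d x : int := (x == [set v])%:R.
  have dW : chain_on e W 1 d.
    by move=> x; rewrite /d; have [-> _|//] := eqVneq x; apply/cliques1P; exists v.
  have bd_d : bd d set0 = 1.
    rewrite (@bd_set0 _ _ _ v) /d ?eqxx // => w ne_wv.
    by rewrite (inj_eq set1_inj) (negbTE ne_wv).
  have z'W := chain_on_lin (c := - bd z set0) zW dW.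
  exists (fun x => z x + - bd z set0 * d x); split=> // [y|x ne_xv]; last first.
    by rewrite /d (negbTE ne_xv) mulr0 addr0.
  have [->|y_nz] := eqVneq y set0; first by rewrite bd_lin bd_d mulr1 subrr.
  by rewrite (chain_on0 (chain_on_bd z'W)) // cliques0.
exists z; split=> // y.
have [->|ne_yv] := eqVneq y [set v]; last first.
  have [yW|] := boolP (y \in cliques e W m.+1); last first.
    by move/(chain_on0 (chain_on_bd zW)).
  apply: bd_z => //; apply: contraTneq yW => ->.
  by apply/cliquesP => -[_ _]; rewrite cards0.
(* The boundary vanishes at every other vertex, so its value at [v] is its augmentation, which is
   zero. *)
rewrite -(@bd_set0 _ _ (bd z)) ?bd_bd // => w ne_wv.
have [yW|] := boolP ([set w] \in cliques e W m.+1); last first.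
  by move/(chain_on0 (chain_on_bd zW)).
apply: bd_z => //; last by rewrite (inj_eq set1_inj).
by apply/set0Pn; exists w; rewrite set11.
Qed.

(** A filling of the lifted cycle lives on simplices with at least two vertices, so it never meets
    the deleted one. *)
Lemma exact_contractible (disp : Order.disp_t) (T : finOrderType disp)
    (e : rel T) (W : {set T}) (v : T) (S : {set {set T}}) :
  symmetric e -> irreflexive e -> contractible e W -> v \in W ->
  (forall x, (x \in S) =
     [&& x \in cliques e W #|x|, x != set0 & x != [set v]]) ->
  exact_on S.
Proof.
move=> e_sym e_irr cW vW S_E m z zS bd_z.
have zW : chain_on e W m.+1 z.
  by move=> x /zS[]; rewrite S_E => /and3P[xW _ _] <-.
have [|z' [z'W z'_cyc z'_z]] := lift_cycle vW zW.
  move=> y yW y0 yv; have [_ _ ym] := cliquesP _ _ _ _ yW.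
  by apply: bd_z => //; rewrite S_E y0 yv ym yW.
have [t tW bd_t] := contractible_acyclic e_sym e_irr cW z'W z'_cyc.
exists t => [x /tW xW|x xS _]; last first.
  by rewrite bd_t z'_z //; move: xS; rewrite S_E => /and3P[].
have [_ _ xm] := cliquesP _ _ _ _ xW; split=> //; rewrite S_E xm xW /=.
by rewrite -card_gt0 xm; apply: contra_eq_neq xm => ->; rewrite cards1.
Qed.

(** Below the top degree the lifted cycle bounds; in the top degree it is a multiple of [sigma]
    vanishing at [x0], hence zero. *)
Lemma exact_sphere (disp : Order.disp_t) (T : finOrderType disp)
    (e : rel T) (W : {set T}) (v : T) (D : nat) (x0 : {set T}) (S : {set {set T}}) :
  sphere_like e D W -> v \in W -> x0 \in cliques e W D -> x0 != [set v] ->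
  (forall x, (x \in S) =
     [&& x \in cliques e W #|x|, x != set0, x != [set v] & x != x0]) ->
  exact_on S.
Proof.
move=> [dimW acW _ _ [sigma [sW s_cyc s1 s_gen]]] vW x0W x0_v S_E m z zS bd_z.
have x0D : #|x0| = D by have [_ _] := cliquesP _ _ _ _ x0W.
have zW : chain_on e W m.+1 z.
  by move=> x /zS[]; rewrite S_E => /and4P[xW _ _ _] <-.
have zero_fill : (forall x, x != [set v] -> z x = 0) ->
    exists2 t : {set T} -> int,
    forall x, t x != 0 -> x \in S /\ #|x| = m.+2 &
    forall x, x \in S -> #|x| = m.+1 -> bd t x = z x.
  move=> z0; exists (fun=> 0) => [x|x]; first by rewrite eqxx.
  by rewrite S_E => /and4P[_ _ xv _] _; rewrite z0 // bd_cst0.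
have [D_m|m_D] := leqP D m.
  apply: zero_fill => x _; apply: chain_on_cst0 zW _ => {}x.
  by apply/negP => /dimW; rewrite ltnNge D_m.
have [|z' [z'W z'_cyc z'_z]] := lift_cycle vW zW.
  move=> y yW y0 yv; have [_ _ ym] := cliquesP _ _ _ _ yW.
  apply: bd_z => //; rewrite S_E y0 yv ym yW /=.
  by apply: contraTneq m_D => yx0; rewrite -x0D -yx0 ym ltnn.
have x0_sq : sigma x0 * sigma x0 = 1.
  by rewrite -expr2 -real_normK ?num_real // s1 // expr1n.
have [m1D|] := ltnP m.+1 D; last first.
  move=> D_m1; have Dm : m.+1 = D by apply/eqP; rewrite eqn_leq m_D.
  rewrite Dm in z'W; have [c z'_c] := s_gen z' z'W z'_cyc.
  have zx0 : z x0 = 0.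
    apply/eqP; apply: contraT => /zS[]; rewrite S_E => /and4P[_ _ _].
    by rewrite eqxx.
  have c0 : c = 0.
    by rewrite -[c]mulr1 -x0_sq mulrA -z'_c z'_z // zx0 mul0r.
  by apply: zero_fill => x xv; rewrite -z'_z // z'_c c0 mul0r.
have [t tW bd_t] := acW _ m1D z' z'W z'_cyc.
(* A filling in the top dimension may use [x0]; a multiple of [sigma] removes it without changing
   the boundary. *)
have [t' [t'W bd_t' t'x0]] : exists t' : {set T} -> int,
    [/\ chain_on e W m.+2 t', bd t' =1 z' & t' x0 = 0].
  have [m2D|m2D] := eqVneq m.+2 D; last first.
    exists t; split=> //; apply: (chain_on0 tW); apply: contra m2D.
    by move=> /cliquesP[_ _]; rewrite x0D => ->.
  rewrite -m2D in sW; exists (fun x => t x + - (t x0 * sigma x0) * sigma x).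
  split; first exact: chain_on_lin.
    by move=> y; rewrite bd_lin bd_t s_cyc mulr0 addr0.
  by rewrite mulNr -mulrA x0_sq mulr1 subrr.
exists t' => [x t'x|x xS _]; last first.
  by rewrite bd_t' z'_z //; move: xS; rewrite S_E => /and4P[].
have xW := t'W _ t'x.
have [_ _ xm] := cliquesP _ _ _ _ xW; split=> //; rewrite S_E xm xW /=.
apply/and3P; split; first by rewrite -card_gt0 xm.
  by apply: contra_eq_neq xm => ->; rewrite cards1.
by apply: contraNneq t'x => ->; rewrite t'x0.
Qed.

(** * Deleting simplices *)


Lemma mem_simplices (T : finType) (e : rel T) (x : {set T}) :
  (x \in simplices e) = (x != set0) && (x \in cliques e [set: T] #|x|).
Proof. by rewrite !inE subsetT eqxx andbT. Qed.

Lemma simplex_orderP (T : finType) (e : rel T) (n : nat) (s : n.-tuple {set T})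
    (x : {set T}) :
  simplex_order e s -> reflect (exists i, x = tnth s i) (x \in simplices e).
Proof. by move=> /andP[/perm_mem s_mem _]; rewrite -mem_enum -s_mem; apply: tnthP. Qed.

Lemma simplex_order_uniq (T : finType) (e : rel T) (n : nat)
    (s : n.-tuple {set T}) : simplex_order e s -> uniq s.
Proof. by move=> /andP[/perm_uniq -> _]; rewrite enum_uniq. Qed.

Lemma simplex_order_dim (T : finType) (e : rel T) (n : nat)
    (s : n.-tuple {set T}) (i j : 'I_n) :
  simplex_order e s -> (i <= j)%N ->
  (Defs.dim (tnth s i) <= Defs.dim (tnth s j))%N.
Proof.
move=> /andP[_ s_sorted] ij; rewrite !(tnth_nth set0).
by apply: (sorted_leq_nth _ _ _ s_sorted) => //;
  [move=> ? ? ?; apply: leq_trans | move=> ?; apply: leqnn | | ];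
  rewrite inE size_tuple.
Qed.

(** The vertex [u] occurs in the list, so the first entry has dimension at most 0. *)
Lemma simplex_order_first (T : finType) (e : rel T) (n : nat)
    (s : n.-tuple {set T}) (u : T) : simplex_order e s ->
  exists (i0 : 'I_n) (v : T), i0 = 0%N :> nat /\ tnth s i0 = [set v].
Proof.
move=> s_ord.
have /(simplex_orderP _ s_ord)[j uj] : [set u] \in simplices e.
  rewrite mem_simplices cards1; apply/andP; split.
    by apply/set0Pn; exists u; rewrite set11.
  by apply/cliques1P; exists u.
pose i0 := Ordinal (leq_ltn_trans (leq0n j) (ltn_ord j)); exists i0.
have := simplex_order_dim s_ord (leq0n j : (i0 <= j)%N).
rewrite -uj /Defs.dim cards1 leqn0 => /eqP i0_dim.
have : tnth s i0 != set0.
  have /(simplex_orderP _ s_ord) : exists i, tnth s i0 = tnth s i by exists i0.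
  by rewrite mem_simplices => /andP[].
rewrite -card_gt0 => i0_gt0.
have /cards1P[v ->] : #|tnth s i0| == 1%N by rewrite -(prednK i0_gt0) i0_dim.
by exists v.
Qed.

Lemma simplex_order_last (T : finType) (e : rel T) (n : nat)
    (s : n.-tuple {set T}) (D : nat) (x : {set T}) :
  simplex_order e s ->
  (forall m y, y \in cliques e [set: T] m -> (m <= D.+1)%N) ->
  x \in cliques e [set: T] D.+1 ->
  exists il : 'I_n, il = n.-1 :> nat /\ tnth s il \in cliques e [set: T] D.+1.
Proof.
move=> s_ord dimT xD; have [_ _ x_card] := cliquesP _ _ _ _ xD.
have /(simplex_orderP _ s_ord)[j xj] : x \in simplices e.
  by rewrite mem_simplices x_card xD -card_gt0 x_card.
have n_gt0 : (0 < n)%N := leq_ltn_trans (leq0n j) (ltn_ord j).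
have il_n : (n.-1 < n)%N by rewrite prednK.
exists (Ordinal il_n); split=> //.
have /(simplex_orderP _ s_ord) : exists i, tnth s (Ordinal il_n) = tnth s i.
  by exists (Ordinal il_n).
rewrite mem_simplices => /andP[y0 yT].
suff -> : D.+1 = #|tnth s (Ordinal il_n)| by [].
apply/eqP; rewrite eqn_leq (dimT _ _ yT) andbT.
have : (j <= Ordinal il_n)%N by rewrite -ltnS prednK.
move/(simplex_order_dim s_ord); rewrite -xj /Defs.dim x_card /=.
by rewrite -card_gt0 in y0; rewrite -(ltn_predK y0).
Qed.

(** Subsets of cliques are cliques and supersets of nonempty sets are nonempty, so only [P] has to
    be checked. *)
Lemma convex_on (T : finType) (e : rel T) (S : {set {set T}})
    (P : pred {set T}) :
  (forall x, (x \in S) = [&& x \in cliques e [set: T] #|x|, x != set0 & P x]) ->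
  (forall w x y : {set T}, w \in S -> x \in S -> w \subset y -> y \subset x -> P y) ->
  forall w x y : {set T}, w \in S -> x \in S ->
    w \subset y -> y \subset x -> y \in S.
Proof.
move=> S_E convP w x y wS xS wy yx; rewrite S_E (convP w x) // andbT.
move: (wS) (xS); rewrite !S_E => /and3P[_ w0 _] /and3P[/cliquesP[_ xe _] _ _].
apply/andP; split.
  by apply/cliquesP; split=> // u v uy vy; apply: xe; apply: (subsetP yx).
apply: contra w0 => /eqP y0; by rewrite -subset0 -y0.
Qed.

Theorem lemma6 (C : numClosedFieldType) (disp : Order.disp_t)
    (T : finOrderType disp) (e : rel T)
    (e_sym : symmetric e) (e_irr : irreflexive e)
    (n : nat) (s : n.-tuple {set T}) (s_order : simplex_order e s) :
  (contractible e [set: T] ->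
     phi C e s = SDetA C s /\ SDetA C s = 1) /\
  (forall d : int, 0 <= d -> sphere e d [set: T] ->
     phi C e s = SDetC C s /\ SDetC C s = 1).
Proof.
have s_uniq := simplex_order_uniq s_order.
have tnth_inj : injective (tnth s) by apply/tuple_uniqP.
have no_set1 (v : T) (w y : {set T}) : w != set0 -> w != [set v] -> w \subset y ->
    y != [set v].
  move=> w0 wv wy; apply: contra_neq wv => yv; apply/eqP.
  by rewrite yv subset1 (negbTE w0) orbF in wy.
split=> [cT|d d_ge0 sphT].
  split; first by rewrite /phi asboolT.
  have [u _] := contractible_neq0 cT.
  have [i0 [v [i0_0 i0_v]]] := simplex_order_first u s_order.
  pose S := [set tnth s i | i in keep_A n].
  have S_E x : (x \in S) =
      [&& x \in cliques e [set: T] #|x|, x != set0 & x != [set v]].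
    rewrite andbCA andbA -mem_simplices.
    apply/imsetP/andP => [[i]|[/(simplex_orderP _ s_order)[i ->] ne_v]].
      rewrite inE => i_gt0 ->; split; first by apply/(simplex_orderP _ s_order); exists i.
      by rewrite -i0_v (inj_eq tnth_inj) -val_eqE /= i0_0 -lt0n.
    exists i => //; rewrite inE lt0n; apply: contra_neq ne_v => i_0.
    by rewrite -i0_v; congr tnth; apply: val_inj; rewrite /= i0_0.
  apply: SDet_exact => //; rewrite -/S.
  - by rewrite S_E eqxx andbF.
  - apply: (convex_on S_E) => w x y; rewrite !S_E => /and3P[_ w0 wv] _ wy _.
    exact: no_set1 wy.
  exact: (exact_contractible e_sym e_irr cT (in_setT v) S_E).
have [D dD sphD] := sphere_sphere_like e_sym e_irr sphT.
case: D dD sphD => [|D] dD sphD; first by lia.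
split.
  by rewrite /phi asboolF //; apply: sphere_not_contractible sphD.
(* Two vertices guarantee that the first and last indices differ; this matters for the 0-sphere,
   whose facets are vertices. *)
have [v1 [v2 ne_v12]] : exists v1 v2 : T, v1 != v2.
  case: sphT d_ge0 => [//|k W _ _ [v1 _ /contractible_neq0[v2]]].
  by move=> /setD1P[ne _] _; exists v2, v1.
have [dimT _ [x xT] _ _] := sphD.
have [i0 [v [i0_0 i0_v]]] := simplex_order_first v1 s_order.
have [il [il_n ilT]] := simplex_order_last s_order dimT xT.
pose S := [set tnth s i | i in keep_C n].
have S_E x' : (x' \in S) = [&& x' \in cliques e [set: T] #|x'|, x' != set0
                             & (x' != [set v]) && (x' != tnth s il)].
  rewrite andbCA andbA -mem_simplices.
  apply/imsetP/andP => [[i]|[/(simplex_orderP _ s_order)[i ->] /andP[ne_v ne_l]]].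
    rewrite inE => /andP[i_gt0 i_lt] ->.
    split; first by apply/(simplex_orderP _ s_order); exists i.
    rewrite -i0_v !(inj_eq tnth_inj) -!val_eqE /= i0_0 -lt0n i_gt0 il_n.
    by rewrite neq_ltn i_lt.
  exists i => //; rewrite inE lt0n; apply/andP; split.
    apply: contra_neq ne_v => i_0.
    by rewrite -i0_v; congr tnth; apply: val_inj; rewrite /= i0_0.
  have i_n := ltn_ord i; have : i != il by rewrite -(inj_eq tnth_inj).
  by rewrite -val_eqE /= il_n; lia.
have x0_v : tnth s il != [set v].
  rewrite -i0_v (inj_eq tnth_inj) -val_eqE /= il_n i0_0 -lt0n.
  have vS (w : T) : exists i, [set w] = tnth s i.
    apply/(simplex_orderP _ s_order); rewrite mem_simplices cards1.
    rewrite -card_gt0 cards1; apply/cliques1P; exists w => //.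
  have [i1 i1E] := vS v1; have [i2 i2E] := vS v2.
  have : i1 != i2 by rewrite -(inj_eq tnth_inj) -i1E -i2E (inj_eq set1_inj).
  by rewrite -val_eqE /=; have := ltn_ord i1; have := ltn_ord i2; lia.
apply: SDet_exact => //; rewrite -/S.
- by rewrite S_E eqxx andbF.
- apply: (convex_on S_E) => w x1 y; rewrite !S_E.
  move=> /and4P[_ w0 wv _] /and4P[x1T _ _ x1_l] wy yx1.
  (* The deleted facet has maximal cardinality, so a simplex containing it equals it and is not
     kept. *)
  rewrite (no_set1 v w) //=; apply: contra x1_l => /eqP y_l.
  rewrite eq_sym eqEcard -y_l yx1 y_l; have [_ _ ->] := cliquesP _ _ _ _ ilT.
  exact: dimT x1T.
exact: (exact_sphere sphD (in_setT v) ilT x0_v S_E).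
Qed.
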